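(* The Local Days On Days Off Scheduling Problem (LDODOSP) can be decided in $\mathcal{O}(D^2)$ time.
   Context: An instance of the Days On Days Off Scheduling Problem (DODOSP) consists of integers $D\ge 1$ (days), $N\ge 1$ (workers), bounds $l_w,u_w,l_o,u_o,U_w,U_o\in\mathbb{N}$, and for each day $d\in\{1,\dots,D\}$ integers $0\le r_l^d\le r_u^d\le N$. A schedule is a map $f:\{n_1,\dots,n_N\}\times\{1,\dots,D\}\to\{\mathrm{ON},\mathrm{OFF}\}$ (not cyclic). A work period (resp. off period) of a worker is an inclusion-wise maximal set of consecutive days on which the worker is ON (resp. OFF). A schedule is feasible if on every day $d$ the number of workers that are ON lies in $[r_l^d,r_u^d]$, every work period has length between $l_w$ and $u_w$, every off period has length between $l_o$ and $u_o$, every worker is ON on at most $U_w$ days and OFF on at most $U_o$ days. The decision problem asks whether a feasible schedule exists. The LDODOSP is the DODOSP restricted to instances with $U_w=U_o=D$. *)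

(* Defs.v *)
From mathcomp Require Import all_boot.
Set Implicit Arguments. Unset Strict Implicit. Unset Printing Implicit Defensive.

(* Days are indexed 0..D-1 (paper: 1..D), workers 0..N-1. *)
Record instance := Inst {
  iD : nat; iN : nat;
  lw : nat; uw : nat; lo : nat; uo : nat; Uw : nat; Uo : nat;
  rl : nat -> nat;  (* r_l^d, meaningful for d < D *)
  ru : nat -> nat   (* r_u^d, meaningful for d < D *)
}.

Definition valid_instance (I : instance) : Prop :=
  1 <= iD I /\ 1 <= iN I /\
  forall d, d < iD I -> rl I d <= ru I d <= iN I.

Definition ldodosp_instance (I : instance) : Prop :=
  valid_instance I /\ Uw I = iD I /\ Uo I = iD I.

(* A schedule: f w d = true iff worker w is ON on day d (true = ON). *)
Definition schedule := nat -> nat -> bool.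

Definition is_period (s : nat -> bool) (D : nat) (b : bool) (i j : nat) : Prop :=
  i <= j /\ j < D /\
  (forall k, i <= k -> k <= j -> s k = b) /\
  (i = 0 \/ s i.-1 = ~~ b) /\
  (j.+1 = D \/ s j.+1 = ~~ b).

Definition feasible_schedule (I : instance) (f : schedule) : Prop :=
  (forall d, d < iD I ->
     rl I d <= count (fun w => f w d) (iota 0 (iN I)) <= ru I d) /\
  (forall w, w < iN I ->
     (forall i j, is_period (f w) (iD I) true i j -> lw I <= j.+1 - i <= uw I) /\
     (forall i j, is_period (f w) (iD I) false i j -> lo I <= j.+1 - i <= uo I) /\
     count (fun d => f w d) (iota 0 (iD I)) <= Uw I /\
     count (fun d => ~~ f w d) (iota 0 (iD I)) <= Uo I).

Definition feasible (I : instance) : Prop := exists f : schedule, feasible_schedule I f.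

(* Memory: infinitely many registers holding naturals.  Each instruction costs
   one step.  Arithmetic: addition and truncated subtraction only (no unit-cost
   multiplication), comparison-jump, indirect load/store. *)
Inductive instr :=
| IConst of nat & nat
| IAdd of nat & nat & nat
| ISub of nat & nat & nat
| ILoad of nat & nat
| IStore of nat & nat
| IJle of nat & nat & nat
| IHalt.

Record config := Cfg { pc : nat; regs : nat -> nat }.

Definition upd (m : nat -> nat) (r v : nat) : nat -> nat :=
  fun x => if x == r then v else m x.

(* Reading past the end of the program means Halt. *)
Definition step (P : seq instr) (c : config) : config :=
  let m := regs c in
  let p := pc c in
  match nth IHalt P p with
  | IConst r k => Cfg p.+1 (upd m r k)
  | IAdd r a b => Cfg p.+1 (upd m r (m a + m b))
  | ISub r a b => Cfg p.+1 (upd m r (m a - m b))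
  | ILoad r a => Cfg p.+1 (upd m r (m (m a)))
  | IStore a b => Cfg p.+1 (upd m (m a) (m b))
  | IJle a b l => Cfg (if m a <= m b then l else p.+1) m
  | IHalt => c
  end.

Definition halted (P : seq instr) (c : config) : bool :=
  if nth IHalt P (pc c) is IHalt then true else false.

(* Configuration after n steps (halted configurations are fixed points). *)
Definition exec (n : nat) (P : seq instr) (c : config) : config := iter n (step P) c.

(* Input encoding: registers 0..7 hold D, N, l_w, u_w, l_o, u_o, U_w, U_o;
   register 8+2d holds r_l^d and 9+2d holds r_u^d for d < D; all others 0. *)
Definition encode (I : instance) : nat -> nat :=
  fun x =>
    if x < 8 then nth 0 [:: iD I; iN I; lw I; uw I; lo I; uo I; Uw I; Uo I] x
    else let y := x - 8 in
         if y./2 < iD I then (if odd y then ru I y./2 else rl I y./2) else 0.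

(* Main.v *)
Require Import Defs.
From mathcomp Require Import all_boot.
From mathcomp Require Import zify.
Set Implicit Arguments. Unset Strict Implicit. Unset Printing Implicit Defensive.

(* With A_d and B_d the numbers of work and off periods begun up to day d by all
   workers together, serving the workers first-in first-out shows that only A
   and B matter: a feasible schedule exists iff a system of O(D) difference
   constraints x_u + p <= x_v + q in the 2 (2 D + 1) unknowns A_d, B_d
   (-D <= d <= D) is solvable.  A solution for N workers splits into N solutions
   for one worker by x |-> (x + w) / N, w < N, whose sum is x.  In-place
   Bellman-Ford relaxation solves such a system, if at all, within one round per
   unknown, so one further round leaves the values unchanged iff the instance is
   feasible; each round takes O(D) steps. *)

(** * Difference constraints *)

(** The totals forget which worker is in which period; they suffice because the length constraints
    merely compare two counts. The offset by N sits inside one of the counts, so the comparisons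
    survive summation over workers and any monotone map that turns a shift by N into a shift by 1.
    The map x |-> (x + w) / N is of this kind and deals successive starts to the workers in
    rotation, which is the first-in first-out order. Periods cut off by the horizon obey both bounds
    as well. Each worker therefore gets the opposite state outside the horizon, so that these
    periods too lie between two switches, and D fictitious earlier days let a bound look back
    without leaving the index range. Convergence is proved without paths or cycles, by lowering a
    solution that lies above the current values. Values only grow, so naturals and truncated
    subtraction suffice. *)

Lemma updE m r v : upd m r v r = v.
Proof. by rewrite /upd eqxx. Qed.

Lemma updN m r v x : x != r -> upd m r v x = m x.
Proof. by rewrite /upd => /negPf ->. Qed.

(* [((v, u), (p, q))] encodes the constraint [s u + p <= s v + q]. *)
Definition cstr := ((nat * nat) * (nat * nat))%type.

Definition sat (s : nat -> nat) (c : cstr) : bool :=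
  s c.1.2 + c.2.1 <= s c.1.1 + c.2.2.

Definition gap (s : nat -> nat) (c : cstr) : nat :=
  s c.1.2 + c.2.1 - c.2.2 - s c.1.1.

(** As [gap] is truncated at zero, this is the maximum of the old value and the value forced by the
    source. *)
Definition relax (s : nat -> nat) (c : cstr) : nat -> nat :=
  upd s c.1.1 (gap s c + s c.1.1).

Fixpoint drift (s : nat -> nat) (cs : seq cstr) : nat :=
  if cs is c :: cs' then gap s c + drift (relax s c) cs' else 0.

Lemma gap_eq0 s c : (gap s c == 0) = sat s c.
Proof. by rewrite /gap /sat; lia. Qed.

Lemma eq_relax s t c : s =1 t -> relax s c =1 relax t c.
Proof. by move=> st x; rewrite /relax /upd /gap !st. Qed.

Lemma eq_drift s t cs : s =1 t -> drift s cs = drift t cs.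
Proof.
elim: cs s t => [|c cs IH] s t st //=.
by rewrite (IH _ _ (eq_relax c st)) /gap !st.
Qed.

Lemma relax_sat s c : sat s c -> relax s c =1 s.
Proof.
rewrite -gap_eq0 => /eqP g0 x; rewrite /relax g0 /upd add0n.
by case: eqP => // ->.
Qed.

(** A pass without drift never moves a value, so it has tested every constraint against the same
    [s]. *)
Lemma drift_eq0 s cs : (drift s cs == 0) = all (sat s) cs.
Proof.
elim: cs s => [|c cs IH] s //=.
rewrite addn_eq0 gap_eq0; case sc: (sat s c) => //=.
by rewrite (eq_drift _ (relax_sat sc)).
Qed.

Lemma foldl_relax_ge cs s x : s x <= foldl relax s cs x.
Proof.
elim: cs s => [|c cs IH] s //=.
apply: leq_trans (IH _); rewrite /relax /upd; case: eqP => [->|//]; exact: leq_addl.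
Qed.

(** Updating in place loses nothing: the source can only have grown before [c] is reached, and the
    target only grows afterwards. *)
Lemma foldl_relax_src cs s c : c \in cs ->
  s c.1.2 + c.2.1 <= foldl relax s cs c.1.1 + c.2.2.
Proof.
elim: cs s => [|c' cs IH] s //=; rewrite inE => /orP[/eqP ->|ccs].
  apply: (@leq_trans (relax s c' c'.1.1 + c'.2.2)).
    by rewrite /relax updE /gap; case: c' => [[v u] [p q]] /=; lia.
  by rewrite leq_add2r foldl_relax_ge.
apply: leq_trans (IH _ ccs); rewrite leq_add2r.
exact: (foldl_relax_ge [:: c']).
Qed.

Lemma foldl_relax_le (V : pred nat) cs s t :
  all (sat t) cs -> all (fun c => V c.1.2 && V c.1.1) cs ->
  (forall x, V x -> s x <= t x) -> forall x, V x -> foldl relax s cs x <= t x.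
Proof.
elim: cs s => [|c cs IH] s //= /andP[tc tcs] /andP[/andP[Vu Vv] Vcs] st.
apply: IH => // x Vx; rewrite /relax /upd; case: eqP => [->|_]; last exact: st.
by have := st _ Vu; have := st _ Vv; move: tc; rewrite /sat /gap; lia.
Qed.

Lemma count_lt (T : eqType) (a b : pred T) (s : seq T) x :
  {in s, forall y, a y -> b y} -> x \in s -> ~~ a x -> b x -> count a s < count b s.
Proof.
elim: s => [|y s IH] //= ab; rewrite inE => /orP[/eqP <-|xs] nax bx.
  rewrite (negPf nax) bx add0n add1n ltnS (@eq_in_count _ _ (predI a b)); last first.
    move=> z zs /=; have := ab z; rewrite inE zs orbT => /(_ isT).
    by case: (a z) => [/(_ isT) ->|].
  by apply: sub_count => z /andP[].
have H : count a s < count b s.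
  by apply: IH => // z zs; apply: ab; rewrite inE zs orbT.
have := ab y; rewrite inE eqxx => /(_ isT).
by case: (a y) => [/(_ isT) ->|_]; move: H; lia.
Qed.

(** * Convergence of in-place Bellman-Ford relaxation *)

Section Convergence.
Variables (cs : seq cstr) (V : seq nat).
Hypothesis csV : all (fun c => (c.1.2 \in V) && (c.1.1 \in V)) cs.

Let round s := foldl relax s cs.

Let lower (s h : nat -> nat) x := if (x \in V) && (h x < s x) then (s x).-1 else s x.

(* Lowering [s] by one where [h] is still below it either gives a smaller
   solution, or breaks a tight constraint whose target the next round settles. *)
Lemma round_progress s h : all (sat s) cs -> {in V, forall x, h x <= s x} ->
  ~~ all (sat (lower s h)) cs ->
  count (fun x => h x == s x) V < count (fun x => round h x == s x) V.
Proof.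
move=> scs hs /allPn[[[v u] [p q]] ccs nsat].
have := allP csV _ ccs; have := allP scs _ ccs; move: nsat.
rewrite /sat /lower /= => nsat satc /andP[uV vV].
have rs : {in V, forall x, round h x <= s x}.
  by move=> x; apply: (foldl_relax_le (V := fun x => x \in V)).
have := foldl_relax_src h ccs; rewrite /= -/(round h) => src_le.
move: nsat; rewrite uV vV /= => nsat.
have := rs _ vV; have := hs _ uV; have := hs _ vV => hv hu rv.
apply: (@count_lt _ _ _ _ v) => //.
- move=> x xV /eqP hx; rewrite eqn_leq rs //= -hx; exact: foldl_relax_ge.
- by move: nsat; case: ifP; case: ifP; lia.
- by move: nsat; case: ifP; case: ifP; lia.
Qed.

Lemma rounds_le s h k : all (sat s) cs -> {in V, forall x, h x <= s x} ->
  {in V, forall x, iter k round h x <= s x}.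
Proof.
move=> scs hs; elim: k => [|k IH] //= x.
exact: (foldl_relax_le (V := fun x => x \in V)).
Qed.

Lemma rounds_ge h k x : h x <= iter k round h x.
Proof. by elim: k => [|k IH] //=; apply: leq_trans IH _; apply: foldl_relax_ge. Qed.

Lemma lower_sum s h : has (fun x => h x < s x) V ->
  \sum_(x <- V) lower s h x < \sum_(x <- V) s x.
Proof.
move=> /hasP[x xV hx]; rewrite !(big_rem x xV) /=.
rewrite -addSn leq_add //; first by rewrite /lower xV hx /=; lia.
by apply: leq_sum => y _; rewrite /lower; case: ifP; lia.
Qed.

(** Induction on the sum of the solution: if lowering it at some round gives a solution, that
    smaller one takes over; otherwise every round settles one more unknown at its value in [s]. *)
Lemma rounds_sat_above h s : all (sat s) cs -> {in V, forall x, h x <= s x} ->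
  all (sat (iter (size V) round h)) cs.
Proof.
have [b] := ubnP (\sum_(x <- V) s x); elim: b s => // b IH s sb scs hs.
have stable k : all (sat (iter (size V) round h)) cs \/
    (forall x, x \in V -> iter k round h x = s x) \/
    k <= count (fun x => iter k round h x == s x) V.
  elim: k => [|k [|[eqk|lek]]]; [by right; right | by left | |].
    right; left => x xV; apply/eqP; rewrite eqn_leq rounds_le //= -(eqk x xV).
    exact: foldl_relax_ge.
  have hks := rounds_le k scs hs.
  case: (boolP (has (fun x => iter k round h x < s x) V)) => [lt_s|nlt]; last first.
    right; left => x xV; apply/eqP; rewrite eqn_leq (rounds_le k.+1 scs hs) //=.
    apply: leq_trans (foldl_relax_ge _ _ _).
    by rewrite leqNgt; apply: contra nlt => ?; apply/hasP; exists x.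
  case: (boolP (all (sat (lower s (iter k round h))) cs)) => [sat_lower|nsat].
    left; apply: (IH (lower s (iter k round h))) => //.
      by have := lower_sum lt_s; move: sb; lia.
    move=> x xV; rewrite /lower xV /=; have := hs x xV.
    by case: ifP => //; have := rounds_ge h k x; lia.
  by right; right; apply: leq_ltn_trans lek _; apply: round_progress.
have eq_sat : (forall x, x \in V -> iter (size V) round h x = s x) ->
    all (sat (iter (size V) round h)) cs.
  move=> eqs; apply/allP => c ccs; move: (allP scs _ ccs) (allP csV _ ccs).
  by rewrite /sat => + /andP[uV vV]; rewrite !eqs.
case: (stable (size V)) => [//|[//|cnt]]; apply: eq_sat => x xV.
have : all (fun x => iter (size V) round h x == s x) V.
  by rewrite all_count eqn_leq cnt count_size.
by move=> /allP/(_ x xV)/eqP.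
Qed.

(* The system is invariant under translation, so the starting point is arbitrary. *)
Lemma rounds_sat h s : all (sat s) cs -> all (sat (iter (size V) round h)) cs.
Proof.
move=> scs; apply: (@rounds_sat_above h (fun x => s x + \sum_(y <- V) h y)).
  by apply/allP => c /(allP scs); rewrite /sat; lia.
by move=> x xV /=; rewrite (big_rem x xV) /=; lia.
Qed.

End Convergence.

(** * Period lengths as difference constraints *)

(* Day [d] has index [D + d].  [s] counts the periods of one kind begun so far,
   [e] those of the other kind, up to constants; the indices below [D] stand for
   days before the horizon, on which [s] and [e] are constant, and index [2 D]
   for a fictitious change of state after the last day. *)
Definition period_system (D l u : nat) (s e : nat -> nat) : Prop :=
  forall d, d < D ->
    [&& s (D + d) <= s (D + d).+1, s d <= s d.+1,
        e (D + d).+1 <= s ((D + d).+1 - l), s (D + d - u) <= e (D + d),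
        s (D + D).-1 <= e (D + D), e D <= s 0 & s D.-1 <= e D].

Definition periods_within (D l u : nat) (f : nat -> bool) (b : bool) : Prop :=
  forall i j, is_period f D b i j -> l <= j.+1 - i <= u.

Lemma eq_period_system D l u s e s' e' :
  s =1 s' -> e =1 e' -> period_system D l u s e -> period_system D l u s' e'.
Proof. by move=> ss' ee' H d dD; rewrite -!ss' -!ee'; apply: H. Qed.

(** This is why no constant is added in [period_system]: bare comparisons pass through any monotone
    map. *)
Lemma period_system_homo D l u s e (phi : nat -> nat) :
  {homo phi : x y / x <= y} -> period_system D l u s e ->
  period_system D l u (phi \o s) (phi \o e).
Proof.
move=> mono H d dD; move: (H d dD); repeat case/andP => ?.
by move=> ?; rewrite /= !mono.
Qed.

Lemma period_system_sum D l u N (s e : nat -> nat -> nat) :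
  (forall w, w < N -> period_system D l u (s w) (e w)) ->
  period_system D l u (fun n => \sum_(w < N) s w n) (fun n => \sum_(w < N) e w n).
Proof.
move=> H d dD; rewrite !leq_sum // => w _; move: (H w (ltn_ord w) d dD);
  by repeat case/andP => ?.
Qed.

(** * Switches of state of a single worker *)

Section Single.
Variables (D : nat) (f : nat -> bool).
Hypothesis D_gt0 : 0 < D.

(** The opposite states outside the horizon make the first period begin, and the last one end, with
    a genuine switch. *)
Definition extended n :=
  if n < D then ~~ f 0 else if n < D + D then f (n - D) else ~~ f D.-1.

(** The initial value has the parity of [~~ f 0], so that an odd value means ON at every index.
    Level [2 k - 1] is then the work period number [k] and level [2 k] the off period number [k]. *)
Fixpoint switches n :=
  if n is m.+1 then switches m + (extended m != extended m.+1) else 1 + f 0.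

Definition starts_on n := (switches n).+1 %/ 2.
Definition starts_off n := switches n %/ 2.

Lemma extended_before n : n < D -> extended n = ~~ f 0.
Proof. by rewrite /extended => ->. Qed.

Lemma extended_day d : d < D -> extended (D + d) = f d.
Proof. by move=> dD; rewrite /extended ltnNge leq_addr ltn_add2l dD addKn. Qed.

Lemma extended_after : extended (D + D) = ~~ f D.-1.
Proof. by rewrite /extended ltnNge leq_addr ltnn. Qed.

Lemma odd_switches n : odd (switches n) = extended n.
Proof.
elim: n => [|n IH] /=; first by rewrite /extended D_gt0; case: (f 0).
by rewrite oddD IH; case: (extended n); case: (extended n.+1).
Qed.

Lemma leq_switches m n : m <= n -> switches m <= switches n.
Proof. by elim: n => [|n IH]; rewrite leq_eqVlt => /orP[/eqP->|] //= /IH; lia. Qed.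

Lemma switches_before n : n < D -> switches n = switches 0.
Proof.
elim: n => [|n IH] // nD; rewrite -IH ?(ltnW nD) //=.
by rewrite !extended_before ?(ltnW nD) // eqxx addn0.
Qed.

Lemma switches_first : switches D.-1 < switches D.
Proof.
have := extended_day D_gt0; have := @extended_before D.-1; rewrite addn0 prednK //.
move=> /(_ (leqnn _)) eb ed.
by rewrite -[in X in _ < X](prednK D_gt0) /= prednK // eb ed; case: (f 0); lia.
Qed.

Lemma switches_last : switches (D + D).-1 < switches (D + D).
Proof.
have DD : D + D = (D + D.-1).+1 by lia.
rewrite DD /= -DD extended_after extended_day; last lia.
by case: (f D.-1); lia.
Qed.

(** Periods are the level sets of [switches], which never skips a value. *)
Lemma switches_level k : switches 0 < k < switches (D + D) ->
  exists i j, [/\ is_period f D (odd k) i j,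
    forall n, (switches n < k) = (n < D + i) &
    forall n, (k < switches n) = (D + j < n)].
Proof.
move=> /andP[k_gt k_lt].
(* Steps are at most one, so the least index where [switches] reaches [n] has value exactly [n]. *)
have jump m n : switches m < n -> (exists p, n <= switches p) ->
    exists2 p, m < p & [/\ switches p.-1 = n.-1, switches p = n &
      forall q, (switches q < n) = (q < p)].
  move=> mn ex; case: (ex_minnP ex) => p np min_p.
  have mp : m < p by rewrite ltnNge; apply/negP => /leq_switches; lia.
  have p1 : switches p.-1 < n by rewrite ltnNge; apply/negP => /min_p; lia.
  have : switches p <= (switches p.-1).+1.
    by rewrite -{1}(ltn_predK mp) /=; case: (_ != _); lia.
  exists p => //; split; [lia | lia | move=> q].
  apply/idP/idP => [qn|qp]; last by have := @leq_switches q p.-1; lia.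
  by rewrite ltnNge; apply/negP => /leq_switches; lia.
have ex1 : exists p, k <= switches p by exists (D + D); lia.
have ex2 : exists p, k.+1 <= switches p by exists (D + D).
have [p p_gt [p1 pk lt_p]] := jump _ _ k_gt ex1.
have [q q_gt [q1 qk lt_q]] := jump p k.+1 ltac:(lia) ex2.
have Dp : D <= p.
  by rewrite leqNgt; apply/negP => /switches_before; lia.
have qD : q <= D + D by rewrite leqNgt -lt_q; lia.
exists (p - D), (q.-1 - D); split; last 2 first.
- by move=> n; rewrite lt_p; lia.
- by move=> n; rewrite ltnNge -ltnS lt_q; lia.
have ext n : n < D -> f n = odd (switches (D + n)).
  by move=> nD; rewrite odd_switches extended_day.
have in_level n : p - D <= n -> n <= q.-1 - D -> switches (D + n) = k.
  move=> pn nq; have := lt_p (D + n); have := lt_q (D + n); lia.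
split; [lia | split; [lia | split; [|split]]].
- by move=> n pn nq; rewrite ext ?in_level //; lia.
- case: (posnP (p - D)) => [->|pD]; [by left | right].
  rewrite ext; last lia.
  have -> : D + (p - D).-1 = p.-1 by lia.
  by rewrite p1 -{2}(ltn_predK k_gt) /= negbK.
- case: (leqP (D + D) q) => [qDD|qDD]; [left; lia | right].
  rewrite ext; last lia.
  have -> : D + (q.-1 - D).+1 = q by lia.
  by rewrite qk.
Qed.

Lemma starts_period_system (lw uw lo uo : nat) :
  0 < lw <= D.+1 -> uw <= D -> 0 < lo <= D.+1 -> uo <= D ->
  periods_within D lw uw f true -> periods_within D lo uo f false ->
  period_system D lw uw starts_on starts_off /\
  period_system D lo uo (fun n => starts_off n + 1) starts_on.
Proof.
move=> lw_gt uwD lo_gt uoD work off.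
have min_len b l u n k : periods_within D l u f b -> 0 < l -> l <= n -> n <= D + D ->
    odd k = b -> switches (n - l) < k -> switches n <= k.
  move=> per l_gt ln nD kb lt_k; rewrite leqNgt; apply/negP => k_lt.
  have := @leq_switches 0 (n - l) isT; have := @leq_switches n (D + D) nD => ? ?.
  have [|i [j [ij lt_i lt_j]]] := @switches_level k; first lia.
  by rewrite kb in ij; have := per _ _ ij; move: lt_k k_lt; rewrite lt_i lt_j; lia.
have max_len b l u n : periods_within D l u f b -> u <= D -> D <= n -> n < D + D ->
    odd (switches n) = b -> switches (n - u) < switches n.
  move=> per uD Dn nD nb; rewrite ltnNge; apply/negP => le_n.
  have := @leq_switches 0 D.-1 isT; have := @leq_switches n (D + D).-1.
  have := switches_first; have := switches_last; have := leq_switches Dn => ? ? ? ? ?.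
  have [|i [j [ij lt_i lt_j]]] := @switches_level (switches n); first lia.
  rewrite nb in ij; have := per _ _ ij; move: (lt_i (n - u)) (lt_j n); lia.
have mono m n := @leq_switches m n.
have mono1 n : switches n.+1 <= (switches n).+1 by rewrite /=; case: (_ != _); lia.
have parity n := odd_switches n.
have first_sw := switches_first; have last_sw := switches_last.
have pre := @switches_before D.-1 ltac:(lia).
have step_first := mono1 D.-1; rewrite prednK // in step_first.
have step_last := mono1 (D + D).-1; rewrite prednK ?addn_gt0 ?D_gt0 // in step_last.
split=> d dD.
- have := mono (D + d) (D + d).+1 (leqnSn _); have := mono d d.+1 (leqnSn _).
  have := mono 0 d isT.
  (* Exactly one of the next two levels is odd, that is, a work period; [lia] picks it by parity. *)
  have := min_len true lw uw (D + d).+1 (switches ((D + d).+1 - lw)).+1 work.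
  have := min_len true lw uw (D + d).+1 (switches ((D + d).+1 - lw)).+2 work.
  have := max_len true lw uw (D + d) work.
  have := mono (D + d - uw) (D + d) (leq_subr _ _).
  rewrite /starts_on /starts_off; lia.
- have := mono (D + d) (D + d).+1 (leqnSn _); have := mono d d.+1 (leqnSn _).
  have := mono 0 d isT.
  have := min_len false lo uo (D + d).+1 (switches ((D + d).+1 - lo)).+1 off.
  have := min_len false lo uo (D + d).+1 (switches ((D + d).+1 - lo)).+2 off.
  have := max_len false lo uo (D + d) off.
  have := mono (D + d - uo) (D + d) (leq_subr _ _).
  rewrite /starts_on /starts_off; lia.
Qed.

Lemma starts_diff d : d < D -> starts_on (D + d) = starts_off (D + d) + f d.
Proof.
by move=> dD; have := odd_switches (D + d); rewrite extended_day // /starts_on /starts_off; lia.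
Qed.

End Single.

(* During a period neither count moves, so comparing them across its two ends
   reads off the bounds on its length. *)
Lemma period_system_within D l u l' u' b (s e : nat -> nat) (f : nat -> bool) :
  0 < l -> 0 < l' ->
  period_system D l u s e -> period_system D l' u' (fun n => e n + 1) s ->
  (forall d, d < D -> s (D + d) = e (D + d) + (f d == b)) ->
  periods_within D l u f b.
Proof.
move=> l_gt l'_gt S S' diff i j [ij [jD [per [left right]]]].
have D_gt0 : 0 < D by lia.
have mono_s m n : m <= n -> n <= D + D -> s m <= s n.
  elim: n => [|n IH]; rewrite leq_eqVlt => /orP[/eqP->|mn] // nD.
  apply: leq_trans (IH mn ltac:(lia)) _; case: (ltnP n D) => Dn.
    by have := S n Dn; lia.
  have := S (n - D) ltac:(lia).
  have -> : D + (n - D) = n by lia.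
  lia.
have mono_e m n : m <= n -> n <= D + D -> e m <= e n.
  elim: n => [|n IH]; rewrite leq_eqVlt => /orP[/eqP->|mn] // nD.
  apply: leq_trans (IH mn ltac:(lia)) _; case: (ltnP n D) => Dn.
    by have := S' n Dn; lia.
  have := S' (n - D) ltac:(lia).
  have -> : D + (n - D) = n by lia.
  lia.
have const t : i <= t -> t <= j -> s (D + t) = s (D + i) /\ e (D + t) + 1 = s (D + i).
  elim: t => [|t IH] it tj.
    have -> : i = 0 by lia.
    by have := diff 0 ltac:(lia); rewrite (per 0) ?eqxx; lia.
  have dt := diff t.+1 ltac:(lia); rewrite (per t.+1) // eqxx in dt.
  case: (ltnP t i) => ti; first by have -> : i = t.+1; lia.
  have [st et] := IH ti ltac:(lia).
  (* A further start of the same kind must wait for a full period of the other kind, of length at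
     least [l' > 0]; hence [s] cannot move on the next day. *)
  have := S' t ltac:(lia); have := mono_e ((D + t).+1 - l') (D + t).
  have := mono_s (D + t) (D + t).+1; rewrite addnS in dt *; lia.
have [sj ej] := const j ij (leqnn _); have [_ ei] := const i (leqnn _) ij.
have before : s (D + i).-1 < s (D + i).
  case: left => [i0|fi].
    have := S 0 D_gt0; rewrite i0 addn0 in ei *; lia.
  case: (posnP i) => [i0|i_gt].
    have := S 0 D_gt0; rewrite i0 addn0 in ei *; lia.
  have := diff i.-1 ltac:(lia); rewrite fi.
  have -> : D + i.-1 = (D + i).-1 by lia.
  by have := mono_e (D + i).-1 (D + i); case: b {per fi right diff} => /=; lia.
have after : s (D + j) <= e (D + j).+1.
  case: right => [jD1|fj].
    have := S 0 D_gt0.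
    have -> : (D + D).-1 = D + j by lia.
    have -> : D + D = (D + j).+1 by lia.
    lia.
  case: (ltnP j.+1 D) => j1D; last first.
    have := S 0 D_gt0.
    have -> : (D + D).-1 = D + j by lia.
    have -> : D + D = (D + j).+1 by lia.
    lia.
  have := diff j.+1 ltac:(lia); rewrite fj addnS.
  by have := mono_s (D + j) (D + j).+1; case: b {per fj left diff} => /=; lia.
have := S j jD; have := mono_s ((D + j).+1 - l) (D + i).-1 => min1 min2.
case: (leqP l (j.+1 - i)) => [_|/= ?]; last lia.
(* A period longer than [u] would still be running on day [i + u], by which [S] requires it to have
   ended. *)
rewrite /= leqNgt; apply/negP => lt_u.
have [_ eu] := const (i + u) ltac:(lia) ltac:(lia).
have := S (i + u) ltac:(lia).
have -> : D + (i + u) - u = D + i by lia.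
lia.
Qed.

(** Hermite's identity: raising [x] by one shifts the summands cyclically, the first one re-entering
    last, increased by one. *)
Lemma sum_divn N x : 0 < N -> \sum_(w < N) (x + w) %/ N = x.
Proof.
move=> N_gt0; elim: x => [|x IH].
  by rewrite big1 // => w _; rewrite add0n divn_small.
case: N N_gt0 IH => // N _ IH.
rewrite big_ord_recr /= -[in RHS]IH big_ord_recl /= addn0.
have -> : (x.+1 + N) %/ N.+1 = x %/ N.+1 + 1.
  by rewrite addSnnS divnDr ?dvdnn // divnn.
suff -> : \sum_(i < N) (x.+1 + i) %/ N.+1 = \sum_(i < N) (x + bump 0 i) %/ N.+1.
  have := IH; rewrite big_ord_recl /= addn0; lia.
by apply: eq_bigr => i _; rewrite /bump add1n addSnnS.
Qed.

(* Periods have length between [1] and [D], so these clampings are harmless;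
   they keep every index occurring in [period_system] between [0] and [2 D]. *)
Definition min_length D l := minn (maxn l 1) D.+1.
Definition max_length D u := minn u D.

Lemma periods_within_clamp D l u f b :
  periods_within D (min_length D l) (max_length D u) f b <-> periods_within D l u f b.
Proof.
by split=> H i j ij; have := H i j ij; case: ij => ij [jD _];
  rewrite /min_length /max_length; lia.
Qed.

(** The offset [iN I] is one unit per worker: off start [k] of a worker ends work period [k], but it
    is work start [k + 1] that ends off period [k]. *)
Definition counting_system (I : instance) (A B : nat -> nat) : Prop :=
  let D := iD I in
  [/\ forall d, d < D -> B (D + d) + rl I d <= A (D + d) <= B (D + d) + ru I d,
      period_system D (min_length D (lw I)) (max_length D (uw I)) A B &
      period_system D (min_length D (lo I)) (max_length D (uo I))
        (fun n => B n + iN I) A].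

Lemma count_iota (p : pred nat) n : count p (iota 0 n) = \sum_(i < n) p i.
Proof.
rewrite -sum1_count big_mkcond /= -[n in iota 0 n]subn0 big_mkord.
by apply: eq_bigr => i _; case: (p i).
Qed.

Lemma feasible_counting I : ldodosp_instance I ->
  feasible I <-> exists A B, counting_system I A B.
Proof.
move=> [[D_gt0 [N_gt0 r_le]] [UwD UoD]].
have lwP l : 0 < min_length (iD I) l <= (iD I).+1 by rewrite /min_length; lia.
have uwP u : max_length (iD I) u <= iD I by rewrite /max_length; lia.
split=> [[f [staff workers]]|[A [B [staff S S']]]].
  pose A n := \sum_(w < iN I) starts_on (iD I) (f w) n.
  pose B n := \sum_(w < iN I) starts_off (iD I) (f w) n.
  have sys w : w < iN I -> _ := fun wN =>
    let: conj won (conj woff _) := workers w wN in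
    starts_period_system D_gt0 (lwP (lw I)) (uwP (uw I)) (lwP (lo I)) (uwP (uo I))
      (proj2 (periods_within_clamp _ _ _ _ _) won)
      (proj2 (periods_within_clamp _ _ _ _ _) woff).
  exists A, B; split.
  - move=> d dD; have := staff d dD; rewrite count_iota.
    have -> : A (iD I + d) = B (iD I + d) + \sum_(w < iN I) f w d.
      by rewrite /A /B -big_split; apply: eq_bigr => w _; apply: starts_diff.
    lia.
  - exact: (@period_system_sum _ _ _ _ (fun w => starts_on (iD I) (f w))
      (fun w => starts_off (iD I) (f w)) (fun w wN => proj1 (sys w wN))).
  - have S := @period_system_sum _ _ _ _ (fun w n => starts_off (iD I) (f w) n + 1)
      (fun w => starts_on (iD I) (f w)) (fun w wN => proj2 (sys w wN)).
    apply: (eq_period_system _ _ S) => // n.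
    by rewrite big_split sum_nat_const card_ord muln1.
pose phi w x := (x + w) %/ iN I.
have phiN w x : phi w (x + iN I) = phi w x + 1.
  by rewrite /phi addnAC divnDr ?dvdnn // divnn N_gt0.
have phi_le w : {homo phi w : x y / x <= y}.
  by move=> x y xy; rewrite leq_div2r ?leq_add2r.
pose f w d := phi w (B (iD I + d)) < phi w (A (iD I + d)).
(* The staffing bounds give [B <= A <= B + N] on each day, so the images under [phi w] differ by 0
   or 1. *)
have fE w d : d < iD I ->
    phi w (A (iD I + d)) = phi w (B (iD I + d)) + f w d.
  move=> dD; have := staff d dD; have := r_le d dD => rl_le staffd.
  have := phi_le w (B (iD I + d)) (A (iD I + d)) ltac:(lia).
  have := phi_le w (A (iD I + d)) (B (iD I + d) + iN I) ltac:(lia).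
  by rewrite phiN /f; lia.
exists f; split=> [d dD|w wN].
  have := staff d dD; rewrite count_iota.
  suff -> : A (iD I + d) = B (iD I + d) + \sum_(w < iN I) f w d by lia.
  have : \sum_(w < iN I) phi w (A (iD I + d)) =
      \sum_(w < iN I) (phi w (B (iD I + d)) + f w d).
    by apply: eq_bigr => w _; apply: fE.
  by rewrite big_split /= !sum_divn.
have Sw := period_system_homo (phi_le w) S.
have S'w : period_system (iD I) (min_length (iD I) (lo I)) (max_length (iD I) (uo I))
    (fun n => phi w (B n) + 1) (phi w \o A).
  by apply: (eq_period_system _ _ (period_system_homo (phi_le w) S')) => // n /=.
split; [|split; [|split]].
- apply/periods_within_clamp; apply: period_system_within Sw S'w _ => //.
  - by case/andP: (lwP (lw I)).
  - by case/andP: (lwP (lo I)).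
  - by move=> d dD; rewrite eqb_id; apply: fE.
(* Both counts are raised by one to match the shape that [period_system_within] expects with [B + 1]
   in the role of [s]. *)
- have Sw1 : period_system (iD I) (min_length (iD I) (lw I)) (max_length (iD I) (uw I))
    (fun n => phi w (A n) + 1) (fun n => phi w (B n) + 1).
    by move=> d dD; have := Sw d dD; rewrite /= !leq_add2r.
  apply/periods_within_clamp; apply: period_system_within S'w Sw1 _ => //.
  - by case/andP: (lwP (lo I)).
  - by case/andP: (lwP (lw I)).
  - by move=> d dD; rewrite /= fE //; case: (f w d); lia.
- by rewrite UwD -[X in _ <= X](size_iota 0) count_size.
- by rewrite UoD -[X in _ <= X](size_iota 0) count_size.
Qed.

(** * The constraints as rows of registers *)

Notation rD := 0 (only parsing).
Notation rN := 1 (only parsing).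
Notation rLW := 2 (only parsing).
Notation rUW := 3 (only parsing).
Notation rLO := 4 (only parsing).
Notation rUO := 5 (only parsing).
Notation r0 := 8 (only parsing).
Notation r1 := 9 (only parsing).
Notation rA0 := 10 (only parsing).
Notation rB0 := 11 (only parsing).
Notation rA := 12 (only parsing).
Notation rB := 13 (only parsing).
Notation rRL := 14 (only parsing).
Notation rRU := 15 (only parsing).

(* Memory of the program: registers below 32, then the staffing bounds
   (interleaved as in the input), then the counts [A] and [B] at indices
   [0, .., 2 D]. *)
Definition addrA D := 32 + (D + D).
Definition addrB D := addrA D + (D + D).+1.

Definition env (I : instance) (d r : nat) : nat :=
  let D := iD I in
  nth 0 [:: D; iN I; min_length D (lw I); max_length D (uw I);
            min_length D (lo I); max_length D (uo I); 0; 0; 0; 1;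
            addrA D + D; addrB D + D; addrA D + D + d; addrB D + D + d;
            rl I d; ru I d] r.

(* A row of registers [((a, b, c), (a', b', c'), (p, q))] denotes the constraint
   with target [a + b - c], source [a' + b' - c'], gain [p] and slack [q]. *)
Definition row := ((nat * nat * nat) * (nat * nat * nat) * (nat * nat))%type.

Definition row_cstr (e : nat -> nat) (w : row) : cstr :=
  let: ((a, b, c), (a', b', c'), (p, q)) := w in
  ((e a + e b - e c, e a' + e b' - e c'), (e p, e q)).

(** Two staffing rows, then seven rows for work periods and seven for off periods. The six rows that
    mention only [rA0] and [rB0] as bases are the same every day; repeating them keeps one uniform
    loop body. *)
Definition rows : seq row := [::
  ((rA, r0, r0), (rB, r0, r0), (rRL, r0));
  ((rB, r0, r0), (rA, r0, r0), (r0, rRU));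
  ((rA, r1, r0), (rA, r0, r0), (r0, r0));
  ((rA, r1, rD), (rA, r0, rD), (r0, r0));
  ((rA, r1, rLW), (rB, r1, r0), (r0, r0));
  ((rB, r0, r0), (rA, r0, rUW), (r0, r0));
  ((rB0, rD, r0), (rA0, rD, r1), (r0, r0));
  ((rA0, r0, rD), (rB0, r0, r0), (r0, r0));
  ((rB0, r0, r0), (rA0, r0, r1), (r0, r0));
  ((rB, r1, r0), (rB, r0, r0), (r0, r0));
  ((rB, r1, rD), (rB, r0, rD), (r0, r0));
  ((rB, r1, rLO), (rA, r1, r0), (r0, rN));
  ((rA, r0, r0), (rB, r0, rUO), (rN, r0));
  ((rA0, rD, r0), (rB0, rD, r1), (rN, r0));
  ((rB0, r0, rD), (rA0, r0, r0), (r0, rN));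
  ((rA0, r0, r0), (rB0, r0, r1), (rN, r0))].

Definition day_cstrs I d : seq cstr := [seq row_cstr (env I d) w | w <- rows].
Definition cstrs_upto I n : seq cstr := flatten [seq day_cstrs I d | d <- iota 0 n].

Lemma sat_addr s v u p q v' u' p' q' :
  v = v' -> u = u' -> p = p' -> q = q' ->
  sat s ((v, u), (p, q)) = (s u' + p' <= s v' + q').
Proof. by move=> -> -> -> ->. Qed.

Lemma sat_day_cstrs I s d : d < iD I ->
  let D := iD I in let N := iN I in
  let A n := s (addrA D + n) in let B n := s (addrB D + n) in
  let lw := min_length D (lw I) in let uw := max_length D (uw I) in
  let lo := min_length D (lo I) in let uo := max_length D (uo I) in
  all (sat s) (day_cstrs I d) =
  [&& B (D + d) + rl I d <= A (D + d) + 0, A (D + d) + 0 <= B (D + d) + ru I d,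
      A (D + d) + 0 <= A (D + d).+1 + 0, A d + 0 <= A d.+1 + 0,
      B (D + d).+1 + 0 <= A ((D + d).+1 - lw) + 0,
      A (D + d - uw) + 0 <= B (D + d) + 0, A (D + D).-1 + 0 <= B (D + D) + 0,
      B D + 0 <= A 0 + 0, A D.-1 + 0 <= B D + 0,
      B (D + d) + 0 <= B (D + d).+1 + 0, B d + 0 <= B d.+1 + 0,
      A (D + d).+1 + 0 <= B ((D + d).+1 - lo) + N,
      B (D + d - uo) + N <= A (D + d) + 0, B (D + D).-1 + N <= A (D + D) + 0,
      A D + 0 <= B 0 + N & B D.-1 + N <= A D + 0].
Proof.
move=> dD D N A B lw uw lo uo; rewrite /= andbT.
repeat (congr (_ && _)); apply: sat_addr => //;
  rewrite /env /= -/D /addrB /addrA /lw /uw /lo /uo /min_length /max_length; lia.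
Qed.

Lemma all_cstrs_upto I (p : pred cstr) n :
  reflect (forall d, d < n -> all p (day_cstrs I d)) (all p (cstrs_upto I n)).
Proof.
apply: (iffP allP) => [H d dn|H c].
  apply/allP => c cd; apply: H; apply/flatten_mapP; exists d => //.
  by rewrite mem_iota.
by move=> /flatten_mapP[d]; rewrite mem_iota => /H /allP; apply.
Qed.

Lemma sat_counting I : 0 < iD I ->
  (exists s, all (sat s) (cstrs_upto I (iD I))) <-> exists A B, counting_system I A B.
Proof.
move=> D_gt0; split=> [[s /all_cstrs_upto ss]|[A [B [staff S S']]]].
  exists (fun n => s (addrA (iD I) + n)), (fun n => s (addrB (iD I) + n)).
  by split=> d dD; have := ss d dD; rewrite sat_day_cstrs // !addn0; lia.
pose s x := if x < addrB (iD I) then A (x - addrA (iD I)) else B (x - addrB (iD I)).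
have sA n : n <= iD I + iD I -> s (addrA (iD I) + n) = A n.
  by move=> nD; rewrite /s ifT ?addKn // /addrB; lia.
have sB n : s (addrB (iD I) + n) = B n by rewrite /s ltnNge leq_addr addKn.
exists s; apply/all_cstrs_upto => d dD; rewrite sat_day_cstrs //.
rewrite !sB !sA; try (rewrite /min_length /max_length; lia).
by have := staff d dD; have := S d dD; have := S' d dD; rewrite !addn0; lia.
Qed.

Lemma day_cstrs_range I d : d < iD I ->
  all (fun c => (addrA (iD I) <= c.1.1 < addrA (iD I) + (4 * iD I + 2)) &&
                (addrA (iD I) <= c.1.2 < addrA (iD I) + (4 * iD I + 2))) (day_cstrs I d).
Proof.
move=> dD; rewrite /= /env /= /addrB /addrA.
have minP l : 0 < min_length (iD I) l <= (iD I).+1 by rewrite /min_length; lia.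
have maxP u : max_length (iD I) u <= iD I by rewrite /max_length; lia.
move: (min_length _ _) (minP (lw I)) (min_length _ _) (minP (lo I)) => lw' lwP lo' loP.
move: (max_length _ _) (maxP (uw I)) (max_length _ _) (maxP (uo I)) => uw' uwP uo' uoP.
by repeat (apply/andP; split); lia.
Qed.

Lemma cstrs_upto_sat I h : 0 < iD I ->
  let cs := cstrs_upto I (iD I) in
  all (sat (iter (4 * iD I + 2) (fun s => foldl relax s cs) h)) cs <->
  exists A B, counting_system I A B.
Proof.
move=> D_gt0 cs; rewrite -sat_counting //; split=> [sat_cs|[s sat_s]].
  by exists (iter (4 * iD I + 2) (fun s => foldl relax s cs) h).
(* The unknowns are the [2 * (2 * D + 1)] consecutive cells from [addrA D] on. *)
rewrite -{1}(size_iota (addrA (iD I)) (4 * iD I + 2)).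
apply: rounds_sat sat_s; apply/all_cstrs_upto => d dD.
by apply: sub_all (day_cstrs_range dD) => c; rewrite !mem_iota andbC.
Qed.

(** * Executing machine code *)

Definition effect (m : nat -> nat) (op : instr) : nat -> nat :=
  match op with
  | IConst r k => upd m r k
  | IAdd r a b => upd m r (m a + m b)
  | ISub r a b => upd m r (m a - m b)
  | ILoad r a => upd m r (m (m a))
  | IStore a b => upd m (m a) (m b)
  | _ => m
  end.

Definition straight (op : instr) : bool :=
  match op with IJle _ _ _ | IHalt => false | _ => true end.

Lemma execD n k P c : exec (n + k) P c = exec k P (exec n P c).
Proof. by rewrite /exec addnC iterD. Qed.

Lemma exec_straight P ops p m :
  all straight ops -> take (size ops) (drop p P) = ops ->
  exec (size ops) P (Cfg p m) = Cfg (p + size ops) (foldl effect m ops).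
Proof.
elim: ops p m => [|op ops IH] p m /=; first by rewrite addn0.
move=> /andP[op_straight ops_straight]; case E: (drop p P) => [|op' P'] //= [op'E take_eq].
rewrite {}op'E in E.
have nth_p : nth IHalt P p = op by rewrite -[p]addn0 -nth_drop E.
have drop_p : drop p.+1 P = P' by rewrite -add1n -drop_drop E /= drop0.
rewrite -[LHS]/(exec (size ops).+1 P (Cfg p m)) -add1n execD.
have -> : exec 1 P (Cfg p m) = Cfg p.+1 (effect m op).
  by rewrite /exec /= /step nth_p; case: (op) op_straight.
by rewrite IH ?drop_p // addSnnS.
Qed.

(** A Hoare triple with a time bound. *)
Definition runs P T p m q (Q : (nat -> nat) -> Prop) : Prop :=
  exists t m', [/\ t <= T, exec t P (Cfg p m) = Cfg q m' & Q m'].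

Lemma runs_seq P T1 T2 p m q r Q1 Q2 :
  runs P T1 p m q Q1 -> (forall m', Q1 m' -> runs P T2 q m' r Q2) ->
  runs P (T1 + T2) p m r Q2.
Proof.
move=> [t1 [m1 [tT1 ex1 /[swap]]]] H /H [t2 [m2 [tT2 ex2 ?]]].
by exists (t1 + t2), m2; split; rewrite ?leq_add // execD ex1.
Qed.

Lemma runs_straight P ops p m q (Q : (nat -> nat) -> Prop) :
  all straight ops -> take (size ops) (drop p P) = ops -> q = p + size ops ->
  Q (foldl effect m ops) -> runs P (size ops) p m q Q.
Proof. by move=> ? ? -> ?; exists (size ops), (foldl effect m ops); rewrite exec_straight. Qed.

Lemma runs_jump P p a b q m (Q : (nat -> nat) -> Prop) :
  nth IHalt P p = IJle a b q -> m a <= m b -> Q m -> runs P 1 p m q Q.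
Proof. by move=> nth_p le_ab Qm; exists 1, m; rewrite /exec /= /step nth_p /= le_ab. Qed.

(** [T] includes the jump back; each round pays one more step for the test, and a last test leaves
    the loop. *)
Lemma runs_while P p a b q T n (Inv : nat -> (nat -> nat) -> Prop) m :
  nth IHalt P p = IJle a b q ->
  (forall k m, Inv k m -> (m a <= m b) = (n <= k)) ->
  (forall k m, k < n -> Inv k m -> runs P T p.+1 m p (Inv k.+1)) ->
  Inv 0 m -> runs P (n * T.+1 + 1) p m q (Inv n).
Proof.
move=> nth_p guard body inv0.
suff loop k m' : Inv (n - k) m' -> k <= n -> runs P (k * T.+1 + 1) p m' q (Inv n).
  by apply: loop; rewrite ?subnn.
elim: k m' => [|k IH] m'.
  rewrite subn0 => inv _; have := guard _ _ inv; rewrite leqnn => le_ab.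
  exact: runs_jump nth_p le_ab inv.
move=> inv kn.
have enter : runs P 1 p m' p.+1 (Inv (n - k.+1)).
  exists 1, m'; split=> //; rewrite /exec /= /step nth_p /= (guard _ _ inv).
  by rewrite leqNgt ltn_subrL (leq_trans _ kn).
have -> : k.+1 * T.+1 + 1 = 1 + (T + (k * T.+1 + 1)) by lia.
apply: runs_seq enter _ => m1 inv1; apply: runs_seq (body _ _ _ inv1) _; first lia.
by move=> m2 inv2; apply: IH; [rewrite subnSK // in inv2 | apply: ltnW].
Qed.

Lemma runs_le P T T' p m q (Q Q' : (nat -> nat) -> Prop) :
  runs P T p m q Q -> T <= T' -> (forall m', Q m' -> Q' m') -> runs P T' p m q Q'.
Proof.
move=> [t [m' [tT ex Qm']]] TT' QQ'; exists t, m'; split=> //; last exact: QQ'.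
exact: leq_trans tT TT'.
Qed.

Lemma exec_halted P p m t : nth IHalt P p = IHalt -> exec t P (Cfg p m) = Cfg p m.
Proof.
by move=> nth_p; elim: t => [|t IH] //; rewrite -addn1 execD IH /exec /= /step nth_p.
Qed.

(** * The program *)

Notation rV := 20 (only parsing).
Notation rU := 21 (only parsing).
Notation rT := 22 (only parsing).
Notation rS := 23 (only parsing).
Notation rC := 24 (only parsing).

(** Truncated subtraction yields the gap without a branch, so a row always costs twelve steps; [rC]
    accumulates the drift. *)
Definition row_code (w : row) : seq instr :=
  let: ((a, b, c), (a', b', c'), (p, q)) := w in
  [:: IAdd rV a b; ISub rV rV c; IAdd rU a' b'; ISub rU rU c';
      ILoad rT rU; IAdd rT rT p; ISub rT rT q; ILoad rS rV; ISub rT rT rS;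
      IAdd rC rC rT; IAdd rT rT rS; IStore rV rT].

Definition row_below (b : nat) (w : row) : bool :=
  let: ((x, y, z), (x', y', z'), (p, q)) := w in
  all (fun r => r < b) [:: x; y; z; x'; y'; z'; p; q].

Definition working (z : nat) (m0 s : nat -> nat) (k : nat) (m : nat -> nat) : Prop :=
  [/\ forall x, x < z -> ~~ (rV <= x <= rC) -> m x = m0 x,
      m rC = k & forall x, z <= x -> m x = s x].

(* Abstracting the memory after each instruction keeps terms linear in size:
   unfolded, every instruction would duplicate the preceding memory. *)
Lemma effect_step (Q : (nat -> nat) -> Prop) m op ops :
  (forall m', (forall x, m' x = effect m op x) -> Q (foldl effect m' ops)) ->
  Q (foldl effect m (op :: ops)).
Proof. exact. Qed.

Lemma row_code_effect z m0 s k m w :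
  32 <= z -> row_below rV w -> working z m0 s k m ->
  let c := row_cstr m0 w in z <= c.1.1 -> z <= c.1.2 ->
  working z m0 (relax s c) (k + gap s c) (foldl effect m (row_code w)).
Proof.
move: w => [[[[a b] c] [[a' b'] c']] [p q]] z32 ok [low mC high] cs zv zu.
rewrite {}/cs in zv zu *; rewrite /= in zv zu ok; rewrite /row_cstr /row_code.
set v := m0 a + m0 b - m0 c in zv *; set u := m0 a' + m0 b' - m0 c' in zu *.
have reg r : r < rV -> m r = m0 r by move=> rV; apply: low; lia.
apply: (effect_step (Q := working _ _ _ _)) => m1 E1; rewrite /= in E1.
apply: (effect_step (Q := working _ _ _ _)) => m2 E2; rewrite /= in E2.
have m2E x : x != rV -> m2 x = m x by move=> xV; rewrite E2 updN // E1 updN.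
have m2V : m2 rV = v.
  by rewrite E2 updE E1 updE E1 updN ?(reg a) ?(reg b) ?(reg c) //; lia.
apply: (effect_step (Q := working _ _ _ _)) => m3 E3; rewrite /= in E3.
apply: (effect_step (Q := working _ _ _ _)) => m4 E4; rewrite /= in E4.
have m4E x : ~~ (rV <= x <= rU) -> m4 x = m x.
  by move=> xV; rewrite E4 updN ?E3 ?updN ?m2E //; lia.
have m4V : m4 rV = v by rewrite E4 updN // E3 updN.
have m4U : m4 rU = u.
  rewrite E4 updE E3 updE E3 updN ?(m2E a') ?(m2E b') ?(m2E c') ?reg //; lia.
apply: (effect_step (Q := working _ _ _ _)) => m5 E5; rewrite /= in E5.
apply: (effect_step (Q := working _ _ _ _)) => m6 E6; rewrite /= in E6.
apply: (effect_step (Q := working _ _ _ _)) => m7 E7; rewrite /= in E7.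
have m5E x : x != rT -> m5 x = m4 x by move=> xT; rewrite E5 updN.
have m6E x : x != rT -> m6 x = m4 x by move=> xT; rewrite E6 updN ?m5E.
have m7E x : x != rT -> m7 x = m4 x by move=> xT; rewrite E7 updN ?m6E.
have m7T : m7 rT = s u + m0 p - m0 q.
  rewrite E7 updE E6 updE E5 updE m4U m4E ?high //; last lia.
  by rewrite m5E ?m6E ?m4E ?reg //; lia.
apply: (effect_step (Q := working _ _ _ _)) => m8 E8; rewrite /= in E8.
have m8S : m8 rS = s v by rewrite E8 updE (m7E rV) // m4V m7E ?m4E ?high //; lia.
have m8E x : x != rS -> m8 x = m7 x by move=> xS; rewrite E8 updN.
apply: (effect_step (Q := working _ _ _ _)) => m9 E9; rewrite /= in E9.
have m9T : m9 rT = gap s (v, u, (m0 p, m0 q)) by rewrite E9 updE m8E // m7T m8S.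
have m9E x : x != rT -> m9 x = m8 x by move=> xT; rewrite E9 updN.
apply: (effect_step (Q := working _ _ _ _)) => m10 E10; rewrite /= in E10.
apply: (effect_step (Q := working _ _ _ _)) => m11 E11; rewrite /= in E11.
have m11E x : ~~ (rV <= x <= rC) -> m11 x = m x.
  by move=> xV; rewrite E11 updN ?E10 ?updN ?m9E ?m8E ?m7E ?m4E //; lia.
have m11C : m11 rC = k + gap s (v, u, (m0 p, m0 q)).
  by rewrite E11 updN // E10 updE m9T m9E // m8E // m7E // m4E // mC.
have m11T : m11 rT = gap s (v, u, (m0 p, m0 q)) + s v.
  by rewrite E11 updE E10 updN // m9T E10 updN // m9E // m8S.
have m11V : m11 rV = v by rewrite E11 updN // E10 updN // m9E // m8E // m7E.
apply: (effect_step (Q := working _ _ _ _)) => m12 E12; rewrite /= in E12; split; rewrite [foldl _ _ _]/=.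
- by move=> x xz xV; rewrite E12 m11V m11T updN ?m11E ?low //; lia.
- by rewrite E12 m11V updN //; lia.
- move=> x zx; rewrite E12 m11V m11T /relax /upd; case: eqP => // _.
  by rewrite m11E ?high //; lia.
Qed.

Lemma rows_code_effect z m0 s k m ws :
  32 <= z -> all (row_below rV) ws -> working z m0 s k m ->
  let cs := [seq row_cstr m0 w | w <- ws] in
  all (fun c => (z <= c.1.1) && (z <= c.1.2)) cs ->
  working z m0 (foldl relax s cs) (k + drift s cs)
    (foldl effect m (flatten [seq row_code w | w <- ws])).
Proof.
move=> z32; elim: ws s k m => [|w ws IH] s k m /=; first by rewrite addn0.
move=> /andP[w_ok ws_ok] work /andP[/andP[zv zu] z_ws].
by rewrite foldl_cat addnA; apply: IH => //; apply: row_code_effect.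
Qed.

Lemma drift_cat s cs cs' : drift s (cs ++ cs') = drift s cs + drift (foldl relax s cs) cs'.
Proof. by elim: cs s => //= c cs IH s; rewrite IH addnA. Qed.

Notation rPtr := 16 (only parsing).
Notation rDays := 17 (only parsing).
Notation rRounds := 18 (only parsing).

(** [IJle b b p] serves as an unconditional jump. *)
Definition while_code (p a b : nat) (body : seq instr) : seq instr :=
  IJle a b (p + size body + 2) :: body ++ [:: IJle b b p].

(* The input is moved up by 24 cells to free the registers below 32; meanwhile
   [N] is parked just above the moved input. *)
Definition move_init : seq instr :=
  [:: IConst 7 32; IAdd 6 0 0; IAdd 6 6 7; IStore 6 1; IAdd 6 0 0; IConst 7 0].

(** Source and target overlap, so cells are copied from the top down. With counter [n] in register 6
    the source is [n + 7] and the target [n + 31]; subtracting 32 leaves [n - 1]. *)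
Definition move_body : seq instr :=
  [:: IConst 1 7; IAdd 6 6 1; ILoad 7 6; IConst 1 24; IAdd 6 6 1; IStore 6 7;
      IConst 1 32; ISub 6 6 1; IConst 7 0].

(** Under truncated subtraction [x + (y - x)] is a maximum and [x - (x - y)] a minimum; register 7
    holds [D + 1]. *)
Definition clamp_min r : seq instr :=
  [:: ISub rT r1 r; IAdd r r rT; ISub rT r 7; ISub r r rT].
Definition clamp_max r : seq instr := [:: ISub rT r rD; ISub r r rT].

Definition restore_N : seq instr :=
  [:: IConst 7 32; IAdd 6 0 0; IAdd 6 6 7; ILoad rN 6].

(** [rRounds] becomes [4 * D + 3]: one round per unknown and one to test. *)
Definition set_params : seq instr :=
  [:: IConst r0 0; IConst r1 1; IAdd 7 rD r1]
  ++ clamp_min rLW ++ clamp_min rLO ++ clamp_max rUW ++ clamp_max rUO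
  ++ [:: IAdd rA0 6 rD; IAdd rB0 rA0 rD; IAdd rB0 rB0 rD; IAdd rB0 rB0 r1;
         IAdd rRounds rD rD; IAdd rRounds rRounds rRounds; IConst 7 3;
         IAdd rRounds rRounds 7].

Definition day_body : seq instr :=
  [:: ILoad rRL rPtr; IAdd rPtr rPtr r1; ILoad rRU rPtr; IAdd rPtr rPtr r1]
  ++ flatten [seq row_code w | w <- rows]
  ++ [:: IAdd rA rA r1; IAdd rB rB r1; ISub rDays rDays r1].

Definition round_init : seq instr :=
  [:: IConst rC 0; IAdd rA rA0 r0; IAdd rB rB0 r0; IConst rPtr 32; IAdd rDays rD r0].

Definition move_pc := size move_init.
Definition relax_pc := move_pc + size move_body + 2.
Definition round_pc := relax_pc + size (restore_N ++ set_params).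
Definition day_pc := round_pc.+1 + size round_init.
Definition round_body : seq instr :=
  round_init ++ while_code day_pc rDays r0 day_body ++ [:: ISub rRounds rRounds r1].
Definition final_pc := round_pc + size round_body + 2.

(** The output [1 - rC] is 1 exactly when the last round had no drift. *)
Definition program : seq instr :=
  move_init ++ while_code move_pc 6 7 move_body ++ (restore_N ++ set_params)
  ++ while_code round_pc rRounds r0 round_body ++ [:: ISub 0 r1 rC; IHalt].

(** * Correctness and running time of the program *)

Definition fixed_regs : seq nat := [:: rD; rN; rLW; rUW; rLO; rUO; r0; r1; rA0; rB0].

Definition writes_below b (op : instr) : bool :=
  match op with
  | IConst r _ | IAdd r _ _ | ISub r _ _ | ILoad r _ => r < b
  | IStore _ _ => false
  | _ => true
  end.

Lemma foldl_effect_high b ops m x :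
  all (writes_below b) ops -> b <= x -> foldl effect m ops x = m x.
Proof.
elim: ops m => //= op ops IH m /andP[op_b ops_b] bx; rewrite IH //.
by case: op op_b => //= *; rewrite updN //; lia.
Qed.

Lemma set_params_effect I m :
  {in [:: rD; rLW; rUW; rLO; rUO], m =1 encode I} -> m (addrA (iD I)) = iN I ->
  let m' := foldl effect m (restore_N ++ set_params) in
  [/\ {in fixed_regs, m' =1 env I 0}, m' rRounds = 4 * iD I + 3 &
      forall x, 32 <= x -> m' x = m x].
Proof.
move=> inputs mN; rewrite foldl_cat.
have [m1 [mD mN1 mLW mUW [mLO mUO m6 m1E]]] : exists m1,
    [/\ m1 rD = iD I, m1 rN = iN I, m1 rLW = lw I, m1 rUW = uw I &
    [/\ m1 rLO = lo I, m1 rUO = uo I, m1 6 = addrA (iD I) &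
    (forall x, 32 <= x -> m1 x = m x) /\ m1 = foldl effect m restore_N]].
  have mE r : r \in [:: rD; rLW; rUW; rLO; rUO] -> m r = encode I r by exact: inputs.
  have aN : m 0 + m 0 + 32 = addrA (iD I).
    by rewrite mE // -[encode I 0]/(iD I) /addrA; lia.
  exists (foldl effect m restore_N); rewrite /= !(updE, updN) //; try lia.
  rewrite aN mN !mE //.
  by do ! split=> //; move=> x x32; rewrite !updN //; lia.
case: m1E => m1E <-; cbv zeta; split.
- move=> r; rewrite !inE.
  repeat case/orP; move/eqP->; lazy -[addn subn env];
    rewrite ?mLW ?mUW ?mLO ?mUO ?mN1 ?m6 ?mD;
    rewrite /env /= /min_length /max_length /addrB; try lia.
- by move: (iD I) mD => D mD; lazy -[addn subn muln]; rewrite mD; lia.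
- move=> x x32; rewrite -m1E // /set_params.
  exact: foldl_effect_high x32.
Qed.

Lemma encode_bound I y : encode I (y + 8) =
  if y./2 < iD I then (if odd y then ru I y./2 else rl I y./2) else 0.
Proof. by rewrite /encode ifF ?addnK //; lia. Qed.

Lemma move_inputs I :
  runs program ((iD I + iD I) * 11 + 7) 0 (encode I) relax_pc (fun m =>
    [/\ {in [:: rD; rLW; rUW; rLO; rUO], m =1 encode I}, m (addrA (iD I)) = iN I &
        forall d, d < iD I -> m (32 + (d + d)) = rl I d /\ m (32 + (d + d)).+1 = ru I d]).
Proof.
set D := iD I; set z := addrA D.
pose inputs := [:: rD; rLW; rUW; rLO; rUO].
(* After [k] rounds the top [k] cells are copied; each write lands above all cells still to be
   read. *)
pose Inv k m := [/\ {in inputs, m =1 encode I}, m z = iN I, m 6 = D + D - k /\ m 7 = 0,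
   (forall x, 8 <= x -> x < 8 + (D + D - k) -> m x = encode I x) &
   (forall x, 8 + (D + D - k) <= x -> x < 8 + (D + D) -> m (x + 24) = encode I x)].
have inputs_lt r : r \in inputs -> (r < 6) && (r != 1).
  by rewrite !inE; repeat case/orP; move/eqP->.
have -> : (D + D) * 11 + 7 = size move_init + ((D + D) * 10.+1 + 1) by rewrite /=; lia.
apply: (@runs_seq _ _ _ _ _ move_pc _ (Inv 0)).
  apply: runs_straight => //.
  have e0 : encode I 0 = D by [].
  have e1 : encode I 1 = iN I by [].
  have aN : encode I 0 + encode I 0 + 32 = z by rewrite e0 /z /addrA; lia.
  rewrite [foldl _ _ _]/= !(updE, updN) //; last by lia.
  rewrite aN e0 e1.
  have z8 : 32 <= z by rewrite /z /addrA; lia.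
  split.
  - by move=> r /inputs_lt rP; rewrite !updN //; lia.
  - by do 2 (rewrite updN; last lia); rewrite updE.
  - by rewrite updE updN // updE subn0.
  - by move=> x x8 xD; rewrite !updN //; rewrite /z /addrA; lia.
  - by move=> x x8 xD; lia.
move=> m0 inv0; apply: (runs_le (Q := Inv (D + D)) _ (leqnn _)).
  apply: (runs_while (n := D + D) (T := 10) (Inv := Inv)) inv0 => //.
    by move=> k m [_ _ [-> ->] _ _]; lia.
  move=> k m kD [ins mz [m6 m7] low high].
  rewrite -[10]/(size move_body + 1).
  apply: (@runs_seq _ _ _ _ _ (move_pc + size move_body).+1 _ (Inv k.+1)); last first.
    by move=> m' inv'; apply: runs_jump inv'.
  apply: runs_straight => //.
  pose a := D + D - k + 7.
  have aD : 8 <= a < 8 + (D + D) by rewrite /a; lia.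
  have zE : z = D + D + 32 by rewrite /z /addrA; lia.
  apply: effect_step => m1 E1; apply: effect_step => m2 E2.
  apply: effect_step => m3 E3; apply: effect_step => m4 E4.
  apply: effect_step => m5 E5; rewrite /= in E1 E2 E3 E4 E5.
  have m26 : m2 6 = a by rewrite E2 updE E1 updN // m6 E1 updE.
  have m37 : m3 7 = encode I a.
    by rewrite E3 updE m26 E2 updN ?E1 ?updN ?low //; rewrite /a in aD *; lia.
  have m57 : m5 7 = encode I a by rewrite E5 updN // E4 updN.
  have m56 : m5 6 = a + 24.
    by rewrite E5 updE E4 updN // E3 updN // m26 E4 updE.
  have m5E (x : nat) : x != 1 -> x != 6 -> x != 7 -> m5 x = m x.
    by move=> x1 x6 x7; rewrite E5 updN ?E4 ?updN ?E3 ?updN ?E2 ?updN ?E1 ?updN.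
  apply: effect_step => m6' E6; rewrite /= m56 m57 in E6.
  apply: effect_step => m7' E7; apply: effect_step => m8 E8.
  apply: effect_step => m9 E9; rewrite /= in E7 E8 E9; rewrite [foldl _ _ _]/=.
  have m9E (x : nat) : x != 1 -> x != 6 -> x != 7 -> m9 x = upd m (a + 24) (encode I a) x.
    move=> x1 x6 x7; transitivity (m6' x).
      by rewrite E9 updN // E8 updN // E7 updN.
    by rewrite E6 /upd; case: eqP => // _; apply: m5E.
  split.
  - by move=> r rI; have := inputs_lt r rI => rP; rewrite m9E ?updN ?ins //; lia.
  - by rewrite m9E ?updN ?mz //; lia.
  - split; last by rewrite E9 updE.
    rewrite E9 updN // E8 updE E7 updN // E6 updN; last lia.
    by rewrite m56 E7 updE /a; lia.
  - by move=> x x8 xk; rewrite m9E ?updN ?low //; rewrite /a; lia.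
  - move=> x xk xD; rewrite m9E /upd; try lia.
    case: eqP => [xa|xa]; first by congr encode; lia.
    by apply: high; move: xa; rewrite /a; lia.
move=> m [ins mz _ _ high]; split=> // d dD.
have hi x : 8 <= x -> x < 8 + (D + D) -> m (x + 24) = encode I x.
  by move=> x8 xD; apply: high; lia.
have -> : 32 + (d + d) = (d + d + 8) + 24 by lia.
have -> : ((d + d + 8) + 24).+1 = ((d + d).+1 + 8) + 24 by lia.
rewrite !hi ?encode_bound; try lia.
have -> : (d + d)./2 = d by lia.
have -> : (d + d).+1./2 = d by lia.
by rewrite dD /= oddD addbb.
Qed.

Section Loops.
Variable I : instance.
Let D := iD I.
Let z := addrA D.

Definition holds_input (m : nat -> nat) : Prop :=
  {in fixed_regs, m =1 env I 0} /\
  forall d, d < D -> m (32 + (d + d)) = rl I d /\ m (32 + (d + d)).+1 = ru I d.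

Lemma eq_holds_input m m' :
  (forall x, x < z -> ~~ (12 <= x <= 24) -> m' x = m x) -> holds_input m -> holds_input m'.
Proof.
move=> mm' [regs staff]; split=> [r rF|d dD].
  rewrite -regs // mm' //; move: rF; rewrite /z /addrA !inE; lia.
have [<- <-] := staff d dD; rewrite !mm' // /z /addrA; lia.
Qed.

Definition day_inv j s k (m : nat -> nat) : Prop :=
  [/\ holds_input m, m rRounds = j,
      [/\ m rA = addrA D + D + k, m rB = addrB D + D + k, m rPtr = 32 + (k + k) &
          m rDays = D - k],
      m rC = drift s (cstrs_upto I k) &
      forall x, z <= x -> m x = foldl relax s (cstrs_upto I k) x].

Lemma cstrs_uptoS k : cstrs_upto I k.+1 = cstrs_upto I k ++ day_cstrs I k.
Proof. by rewrite /cstrs_upto -addn1 iotaD map_cat flatten_cat; congr (_ ++ _); apply: cats0. Qed.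

Lemma day_body_effect j s k m : k < D -> day_inv j s k m ->
  day_inv j s k.+1 (foldl effect m day_body).
Proof.
move=> kD [input mJ [mA mB mPtr mDays] mC high].
have z32 : 32 <= z by rewrite /z /addrA; lia.
have [regs staff] := input; have [mrl mru] := staff k kD.
have m9 : m r1 = 1 by apply: regs.
apply: effect_step => m1 E1; apply: effect_step => m2 E2.
apply: effect_step => m3 E3; apply: effect_step => m4 E4; rewrite /= in E1 E2 E3 E4.
have m1E x : x != rRL -> m1 x = m x by move=> xr; rewrite E1 updN.
have m2E x : x != rRL -> x != rPtr -> m2 x = m x by move=> xr xp; rewrite E2 updN ?m1E.
have m4E x : ~~ (rRL <= x <= rPtr) -> m4 x = m x.
  by move=> xP; rewrite E4 updN ?E3 ?updN ?m2E; lia.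
have m2P : m2 rPtr = (32 + (k + k)).+1.
  by rewrite E2 updE !m1E // mPtr m9 addn1.
have m4RL : m4 rRL = rl I k.
  by rewrite E4 updN // E3 updN // E2 updN // E1 updE mPtr mrl.
have m4RU : m4 rRU = ru I k.
  by rewrite E4 updN // E3 updE m2P m2E ?mru; lia.
have m4P : m4 rPtr = 32 + (k.+1 + k.+1).
  by rewrite E4 updE E3 updN // m2P E3 updN // m2E // m9; lia.
have input4 : holds_input m4.
  by apply: eq_holds_input input => x _ xP; apply: m4E; lia.
have cs4 : [seq row_cstr m4 w | w <- rows] = day_cstrs I k.
  have env4 : {in fixed_regs ++ [:: rA; rB; rRL; rRU], m4 =1 env I k}.
    move=> r; rewrite mem_cat => /orP[rF|].
      rewrite input4.1 //; move: rF; rewrite !inE.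
      by repeat case/orP; move/eqP->.
    rewrite !inE; repeat case/orP; move/eqP-> => //; rewrite m4E //.
  by rewrite /day_cstrs /= !env4.
have work4 : working z m4 (foldl relax s (cstrs_upto I k)) (drift s (cstrs_upto I k)) m4.
  by split=> // [|x zx]; [rewrite m4E | rewrite m4E ?high //; lia].
have := @rows_code_effect _ _ _ _ _ rows z32 isT work4; rewrite cs4 => work5.
have {}work5 := work5 _; rewrite -foldl_cat -drift_cat -cstrs_uptoS in work5.
have [|low5 mC5 high5] := work5.
  by apply: sub_all (day_cstrs_range kD) => c; rewrite -/z; lia.
rewrite -[foldl _ _ _]/(foldl effect m4 (flatten [seq row_code w | w <- rows] ++
  [:: IAdd rA rA r1; IAdd rB rB r1; ISub rDays rDays r1])) foldl_cat.
move: (foldl effect m4 _) low5 mC5 high5 => m5 low5 mC5 high5.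
have m5E x : x < 20 -> m5 x = m4 x by move=> x20; apply: low5; lia.
apply: effect_step => m6 E6; apply: effect_step => m7 E7; apply: effect_step => m8 E8.
rewrite /= in E6 E7 E8; rewrite [foldl _ _ _]/=.
have m8E x : x != rA -> x != rB -> x != rDays -> m8 x = m5 x.
  by move=> xA xB xDays; rewrite E8 updN // E7 updN // E6 updN.
have m59 : m5 9 = 1 by rewrite m5E // m4E.
split.
- apply: eq_holds_input input4 => x xz xP; rewrite m8E ?low5 //; lia.
- by rewrite m8E // m5E // m4E.
- split.
  + by rewrite E8 updN // E7 updN // E6 updE m59 m5E // m4E // mA; lia.
  + by rewrite E8 updN // E7 updE E6 updN // E6 updN // m59 m5E // m4E // mB; lia.
  + by rewrite m8E // m5E.
  + rewrite E8 updE !E7 !updN // !E6 !updN // m59 m5E // m4E // mDays; lia.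
- by rewrite m8E.
- by move=> x zx; rewrite m8E ?high5 //; lia.
Qed.

Let cs := cstrs_upto I D.
Let round s := foldl relax s cs.

(** [rC] is reset in each round, so it reports the last completed one, and nothing before the
    first. *)
Definition round_inv s k (m : nat -> nat) : Prop :=
  [/\ holds_input m, m rRounds = 4 * D + 3 - k,
      0 < k -> m rC = drift (iter k.-1 round s) cs &
      forall x, z <= x -> m x = iter k round s x].

Lemma round_runs s k m : k < 4 * D + 3 -> round_inv s k m ->
  runs program (size round_init + (D * (size day_body + 2) + 3)) round_pc.+1 m round_pc
    (round_inv s k.+1).
Proof.
move=> kn [input mJ _ high]; have [regs _] := input.
have z32 : 32 <= z by rewrite /z /addrA; lia.
set s' := iter k round s in high.
apply: (@runs_seq _ _ _ _ _ day_pc _ (day_inv (4 * D + 3 - k) s' 0)).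
  apply: runs_straight => //.
  have [m0 m8] : m rD = D /\ m r0 = 0 by split; apply: regs.
  have [m10 m11] : m rA0 = addrA D + D /\ m rB0 = addrB D + D by split; apply: regs.
  apply: effect_step => m1 E1; apply: effect_step => m2 E2; apply: effect_step => m3 E3.
  apply: effect_step => m4 E4; apply: effect_step => m5 E5.
  rewrite /= in E1 E2 E3 E4 E5; rewrite [foldl _ _ _]/=.
  have m5E x : ~~ (12 <= x <= 24) -> m5 x = m x.
    move=> xP; rewrite E5 updN; last lia.
    rewrite E4 updN; last lia.
    by rewrite E3 updN ?E2 ?updN ?E1 ?updN //; lia.
  split.
  - by apply: eq_holds_input input => x _; apply: m5E.
  - by rewrite E5 updN // E4 updN // E3 updN // E2 updN // E1 updN.
  - split.
    + by rewrite E5 updN // E4 updN // E3 updN // E2 updE !E1 !updN // m10 m8.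
    + by rewrite E5 updN // E4 updN // E3 updE !E2 !updN // !E1 !updN // m11 m8.
    + by rewrite E5 updN // E4 updE.
    + rewrite E5 updE !E4 !updN // !E3 !updN // !E2 !updN // !E1 !updN // m0 m8; lia.
  - by rewrite E5 updN // E4 updN // E3 updN // E2 updN // E1 updE.
  - by move=> x zx; rewrite m5E ?high //; lia.
have -> : D * (size day_body + 2) + 3 = (D * (size day_body + 1).+1 + 1) + (1 + 1) by lia.
move=> m1 inv1.
apply: (@runs_seq _ _ _ _ _ (day_pc + size day_body + 2) _ (day_inv (4 * D + 3 - k) s' D)).
  apply: (runs_while (Inv := day_inv (4 * D + 3 - k) s')) inv1 => //.
    move=> k' m2 [[regs2 _] _ [_ _ _ ->] _ _].
    by rewrite regs2 // -[env I 0 r0]/0; lia.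
  move=> k' m2 k'D inv2.
  apply: (@runs_seq _ _ _ _ _ (day_pc + size day_body).+1 _ (day_inv (4 * D + 3 - k) s' k'.+1)).
    by apply: runs_straight => //; apply: day_body_effect.
  by move=> m3 inv3; apply: runs_jump inv3.
move=> m2 [input2 mJ2 _ mC2 high2].
apply: (@runs_seq _ _ _ _ _ (round_pc + size round_body).+1 _ (round_inv s k.+1)); last first.
  by move=> m3 inv3; apply: runs_jump inv3.
apply: (@runs_straight _ [:: ISub rRounds rRounds r1]) => //.
apply: effect_step => m3 E3; rewrite /= in E3; rewrite [foldl _ _ _]/=.
have m29 : m2 r1 = 1 by apply: input2.1.
have m3E x : x != rRounds -> m3 x = m2 x by move=> xR; rewrite E3 updN.
split.
- by apply: eq_holds_input input2 => x _ xP; apply: m3E; lia.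
- by rewrite E3 updE mJ2 m29; lia.
- by rewrite m3E.
- by move=> x zx; rewrite m3E ?high2 //; lia.
Qed.

Lemma program_runs :
  runs program ((D + D) * 11 + 7 + (size (restore_N ++ set_params) +
      ((4 * D + 3) * (size round_init + (D * (size day_body + 2) + 3)).+1 + 1 + 1)))
    0 (encode I) final_pc.+1 (fun m => exists h,
      m 0 = 1 - drift (iter (4 * D + 2) round h) cs).
Proof.
apply: runs_seq (move_inputs I) _ => m [inputs mN bounds].
have [regs mJ high] := set_params_effect inputs mN.
set m1 := foldl _ _ _ in regs mJ high.
(* The unknowns start from whatever memory holds, including the [N] parked at [addrA D]; any start
   converges. *)
apply: (@runs_seq _ _ _ _ _ round_pc _ (round_inv m1 0)).
  apply: runs_straight => //; split=> //; last by rewrite subn0.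
move=> m2 inv2.
apply: (@runs_seq _ _ _ _ _ final_pc _ (round_inv m1 (4 * D + 3))).
  apply: (runs_while (Inv := round_inv m1)) inv2 => //; last exact: round_runs.
  move=> k m3 [[regs3 _] -> _ _].
  by rewrite regs3 // -[env I 0 r0]/0; lia.
move=> m3 [[regs3 _] _ mC _].
apply: (@runs_straight _ [:: ISub 0 r1 rC]); rewrite ?addn1 //.
exists m1; rewrite [foldl _ _ _]/= updE mC; last lia.
rewrite regs3 // -[env I 0 r1]/1; congr (1 - drift (iter _ _ _) _); lia.
Qed.

End Loops.

(* There is a RAM program deciding LDODOSP within c * D^2 steps:
   on every LDODOSP instance it halts within c*D^2 steps, with output
   register 0 equal to 1 iff a feasible schedule exists. *)
Theorem theorem5p1 :
  exists (P : seq instr) (c : nat),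
    forall I : instance, ldodosp_instance I ->
      let cf := exec (c * iD I ^ 2) P (Cfg 0 (encode I)) in
      halted P cf /\ (regs cf 0 = 1 <-> feasible I).
Proof.
(* The time bound is [804 D^2 + 661 D + 63], below [2000 D^2] as [D >= 1]; the remaining steps are
   spent in the halted state. *)
exists program, 2000 => I Iok cf.
have D_gt0 : 0 < iD I by case: Iok => [[]].
have [t [m [tT ex [h m0]]]] := program_runs I.
have cfE : cf = Cfg final_pc.+1 m.
  rewrite /cf -(subnK (m := t) (n := 2000 * iD I ^ 2)); last first.
    have sizes : size (restore_N ++ set_params) = 27 /\ size day_body = 199 by [].
    apply: leq_trans tT _; rewrite sizes.1 sizes.2 -[size round_init]/5 -mulnn.
    by nia.
  by rewrite addnC execD ex exec_halted.
rewrite cfE /halted /=; split=> //.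
rewrite (feasible_counting Iok) -(cstrs_upto_sat h D_gt0) -drift_eq0 m0.
by lia.
Qed.
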